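(* Let $k\ge 2$. The monoid $\mathsf{riAut}(k)$ is a projective limit of finite inverse monoids, hence $\mathsf{riAut}(k)$ is residually finite.
   Context: Let $A$ be an alphabet with $|A|=k\ge 2$ and $A^*$ the free monoid over $A$. A right ideal is a set $R\subseteq A^*$ with $RA^*\subseteq R$; it is essential iff it intersects every (nonempty) right ideal of $A^*$. $\mathsf{riAut}(k)$ is the set of all bijections $\varphi:R_1\to R_2$ between finitely generated essential right ideals of $A^*$ satisfying $\varphi(xw)=\varphi(x)w$ for all $x\in R_1$, $w\in A^*$; it is an inverse monoid under composition of partial functions. A monoid $M$ is residually finite iff for all $x\ne y$ in $M$ there is a homomorphism from $M$ to a finite monoid that separates $x$ and $y$.
   Formalization: The projective limit claim is proved for riAut(k) with a zero (the empty map) adjoined, since riAut(k) itself is not such a limit: the identities on AⁿA* form a decreasing chain of idempotents with no lower bound. Residual finiteness is proved for riAut(k) itself. *)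

(* Defs.v *)
From HB Require Import structures.
From mathcomp Require Import all_boot all_order.
From mathcomp Require Import boolp classical_sets cardinality.

Set Implicit Arguments.
Unset Strict Implicit.
Unset Printing Implicit Defensive.

Local Open Scope classical_set_scope.
Local Open Scope group_scope.

Section RightIdeals.
Variable A : finType.
Implicit Types R S : set (seq A).

Definition right_ideal R := forall x w, R x -> R (x ++ w).

Definition finitely_generated R :=
  exists P : seq (seq A), R = [set p ++ w | p in [set` P] & w in [set: seq A]].

Definition essential R :=
  forall S, right_ideal S -> S !=set0 -> R `&` S !=set0.

Definition fg_essential R := [/\ right_ideal R, finitely_generated R & essential R].

Lemma fgP R (P : seq (seq A)) :
  R = [set p ++ w | p in [set` P] & w in [set: seq A]] ->
  forall x, R x <-> exists2 p, p \in P & exists w, x = p ++ w.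
Proof.
move=> -> x; split.
  by move=> [p Pp [w _ <-]]; exists p => //; exists w.
by move=> [p Pp [w ->]]; exists p => //; exists w.
Qed.

Lemma fgI (P : seq (seq A)) R :
  (forall x, R x <-> exists2 p, p \in P & exists w, x = p ++ w) ->
  finitely_generated R.
Proof.
move=> PE; exists P; apply/seteqP; split=> x.
  by move=> /PE[p Pp [w ->]]; exists p => //; exists w.
by move=> [p Pp [w _ <-]]; apply/PE; exists p => //; exists w.
Qed.

Lemma fg_essentialT : fg_essential [set: seq A].
Proof.
split=> //; first by apply: (@fgI [:: [::]]) => x; split=> // _;
  exists [::]; rewrite ?inE //; exists x.
by move=> S _ [x Sx]; exists x.
Qed.

Lemma cat_comparable (p q u v : seq A) : p ++ u = q ++ v ->
  (exists w, q = p ++ w) \/ (exists w, p = q ++ w).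
Proof.
elim: p q => [|a p IH] [|b q] /=; try by left; eexists.
  by right; eexists.
by move=> [-> /IH[][w ->]]; [left|right]; exists w.
Qed.

Lemma fg_essentialI R S :
  fg_essential R -> fg_essential S -> fg_essential (R `&` S).
Proof.
move=> [rR [P RP] eR] [rS [Q SQ] eS].
have PE := fgP RP; have QE := fgP SQ; split.
- by move=> x w [Rx Sx]; split; [apply: rR | apply: rS].
- apply: (@fgI ([seq p <- P | `[< S p >]] ++ [seq q <- Q | `[< R q >]])) => x.
  split=> [[/PE[p Pp [u xE]] /QE[q Qq [v xE']]]|[p]].
    have [[w qE]|[w pE]] := cat_comparable (etrans (esym xE) xE').
      exists q; last by exists v.
      rewrite mem_cat !mem_filter Qq andbT; apply/orP; right.
      by apply/asboolP; rewrite qE; apply: rR; apply/PE; exists p => //; exists [::]; rewrite cats0.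
    exists p; last by exists u.
    rewrite mem_cat !mem_filter Pp andbT; apply/orP; left.
    by apply/asboolP; rewrite pE; apply: rS; apply/QE; exists q => //; exists [::]; rewrite cats0.
  rewrite mem_cat !mem_filter => /orP[] /andP[/asboolP h pin] [w ->].
    split; last exact: rS.
    by apply/PE; exists p => //; exists w.
  split; first exact: rR.
  by apply/QE; exists p => //; exists w.
- move=> T rT T0; have : S `&` T !=set0 by exact: eS.
  move=> /eR []; first by move=> x w [Sx Tx]; split; [apply: rS | apply: rT].
  by move=> x [Rx [Sx Tx]]; exists x.
Qed.

End RightIdeals.

Section RiAut.
Variable A : finType.
Implicit Types f g : seq A -> option (seq A).

(* A partial map on the free monoid is a total map into option. *)
Definition pdom f : set (seq A) := [set x | exists y, f x = Some y].
Definition pimg f : set (seq A) := [set y | exists x, f x = Some y].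

Definition is_riAut f := [/\ fg_essential (pdom f), fg_essential (pimg f),
  forall x x' y, f x = Some y -> f x' = Some y -> x = x' &
  forall x y w, f x = Some y -> f (x ++ w) = Some (y ++ w)].

Lemma is_riAut_id : is_riAut (@Some (seq A)).
Proof.
have dT : pdom (@Some (seq A)) = setT.
  by apply/seteqP; split=> // x _; exists x.
have iT : pimg (@Some (seq A)) = setT.
  by apply/seteqP; split=> // x _; exists x.
split; rewrite ?dT ?iT; try exact: fg_essentialT.
  by move=> x x' y [->] [->].
by move=> x y w [->].
Qed.

Lemma fg_essential_image f R : is_riAut f -> fg_essential R ->
  R `<=` pdom f -> fg_essential [set y | exists2 x, R x & f x = Some y].
Proof.
move=> [_ [rI _ eI] inj equi] [rR [P RP] eR] sub.
have PE := fgP RP; split.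
- by move=> y w [x Rx fx]; exists (x ++ w); [exact: rR | exact: equi].
- apply: (@fgI _ (pmap f P)) => y; split.
    move=> [x /PE[p Pp [w ->]] fpw].
    have [|z fp] := sub p; first by apply/PE; exists p => //; exists [::]; rewrite cats0.
    exists z; first by rewrite mem_pmap; apply/mapP; exists p.
    by exists w; move: fpw; rewrite (equi _ _ _ fp) => -[].
  move=> [z]; rewrite mem_pmap => /mapP[p Pp /esym fp] [w ->].
  exists (p ++ w); last exact: equi.
  by apply/PE; exists p => //; exists w.
- move=> S rS S0; have [y [[x fx] Sy]] := eI _ rS S0.
  have [||z [Rz [t St fz]]] := eR [set z | exists2 t, S t & f z = Some t].
  + by move=> z w [t St fz]; exists (t ++ w); [exact: rS | exact: equi].
  + by exists x, y.
  by exists t; split => //; exists z.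
Qed.

Definition pinv f y : option (seq A) :=
  if pselect (exists x, f x = Some y) is left h then Some (projT1 (cid h)) else None.

Lemma pinvP f x y : is_riAut f -> pinv f y = Some x <-> f x = Some y.
Proof.
move=> [_ _ inj _]; rewrite /pinv; case: pselect => [h|h].
  case: cid => z /= fz; split=> [[<-] //|fx].
  by congr Some; exact: inj fz fx.
by split=> // fx; case: h; exists x.
Qed.

Lemma is_riAut_inv f : is_riAut f -> is_riAut (pinv f).
Proof.
move=> fA; have [d i inj equi] := fA; split.
- suff -> : pdom (pinv f) = pimg f by [].
  by apply/seteqP; split=> y [x /(pinvP _ _ fA) fx]; exists x => //; apply/pinvP.
- suff -> : pimg (pinv f) = pdom f by [].
  by apply/seteqP; split=> x [y /(pinvP _ _ fA) fx]; exists y => //; apply/pinvP.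
- by move=> y y' x /(pinvP _ _ fA) fx /(pinvP _ _ fA); rewrite fx => -[].
by move=> y x w /(pinvP _ _ fA) fx; apply/pinvP => //; exact: equi.
Qed.

Lemma is_riAut_comp f g : is_riAut f -> is_riAut g -> is_riAut (pcomp f g).
Proof.
move=> fA gA; have [df imf injf ef] := fA; have [dg img injg eg] := gA.
have I := fg_essentialI df img; split.
- suff -> : pdom (pcomp f g) =
      [set x | exists2 y, (pdom f `&` pimg g) y & pinv g y = Some x].
    apply: fg_essential_image => //; first exact: is_riAut_inv.
    by move=> y [_ [x gx]]; exists x; apply/pinvP.
  apply/seteqP; split=> x.
    move=> [z]; rewrite /pcomp /=; case gx: (g x) => [y|] //= fy.
    by exists y; [split; [exists z | exists x] | apply/pinvP].
  move=> [y [[z fy] _] /(pinvP _ _ gA) gx].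
  by exists z; rewrite /pcomp gx.
- suff -> : pimg (pcomp f g) =
      [set z | exists2 y, (pdom f `&` pimg g) y & f y = Some z].
    by apply: fg_essential_image => // y [].
  apply/seteqP; split=> z.
    move=> [x]; rewrite /pcomp /=; case gx: (g x) => [y|] //= fy.
    by exists y => //; split; [exists z | exists x].
  by move=> [y [_ [x gx]] fy]; exists x; rewrite /pcomp gx.
- move=> x x' z; rewrite /pcomp.
  case gx: (g x) => [y|] //= fy; case gx': (g x') => [y'|] //= fy'.
  by move: gx'; rewrite -(injf _ _ _ fy fy'); exact: injg.
move=> x z w; rewrite /pcomp; case gx: (g x) => [y|] //= fy.
by rewrite (eg _ _ _ gx) /= (ef _ _ _ fy).
Qed.

End RiAut.

Record riAut (A : finType) := RiAut {
  riAut_fun :> seq A -> option (seq A);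
  riAutP : is_riAut riAut_fun }.

Lemma riAut_inj (A : finType) (f g : riAut A) : f =1 g -> f = g.
Proof.
case: f g => [f fP] [g gP] /= /funext fg.
by rewrite fg in fP *; congr RiAut; exact: Prop_irrelevance.
Qed.

HB.instance Definition _ (A : finType) := gen_eqMixin (riAut A).
HB.instance Definition _ (A : finType) := gen_choiceMixin (riAut A).

Section RiAutMonoid.
Variable A : finType.

Definition riAut_one : riAut A := RiAut (is_riAut_id A).
Definition riAut_mul (f g : riAut A) : riAut A :=
  RiAut (is_riAut_comp (riAutP f) (riAutP g)).

Lemma riAut_mulA : associative riAut_mul.
Proof.
by move=> f g h; apply: riAut_inj => x /=; rewrite /pcomp; case: (h x).
Qed.

Lemma riAut_mul1 : left_id riAut_one riAut_mul.
Proof. by move=> f; apply: riAut_inj => x /=; rewrite /pcomp; case: (f x). Qed.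

Lemma riAut_mulr1 : right_id riAut_one riAut_mul.
Proof. by move=> f; apply: riAut_inj. Qed.

HB.instance Definition _ :=
  isMonoid.Build (riAut A) riAut_mulA riAut_mul1 riAut_mulr1.

End RiAutMonoid.

(* The zero None is adjoined even if M already has one; with_zero (riAut A) is
   riAut A together with the empty map. *)
Definition with_zero (M : monoidType) := option M.

HB.instance Definition _ (M : monoidType) := Choice.on (with_zero M).

Section WithZero.
Variable M : monoidType.

Definition with_zero_mul (x y : with_zero M) : with_zero M :=
  if x is Some a then if y is Some b then Some (a * b) else None else None.

Lemma with_zero_mulA : associative with_zero_mul.
Proof. by move=> [x|] [y|] [z|] //=; rewrite mulgA. Qed.

Lemma with_zero_mul1 : left_id (Some 1 : with_zero M) with_zero_mul.
Proof. by move=> [x|] //=; rewrite mul1g. Qed.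

Lemma with_zero_mulr1 : right_id (Some 1 : with_zero M) with_zero_mul.
Proof. by move=> [x|] //=; rewrite mulg1. Qed.

HB.instance Definition _ :=
  isMonoid.Build (with_zero M) with_zero_mulA with_zero_mul1 with_zero_mulr1.

End WithZero.

Definition finite_monoid (M : monoidType) := finite_set [set: M].

Definition inverse_monoid (M : monoidType) :=
  forall x : M, exists! y : M, x * y * x = x /\ y * x * y = y.

Lemma riAut_inverse (A : finType) : inverse_monoid (riAut A).
Proof.
move=> f; have fA := riAutP f.
have fgf (g : riAut A) : f * g * f = f ->
    forall x y, f x = Some y -> g y = Some x.
  move=> E x y fx; have := congr1 (fun h : riAut A => h x) E.
  rewrite /= /pcomp fx /=; case gy: (g y) => [z|] //= fz.
  by have [_ _ inj _] := fA; rewrite (inj _ _ _ fz fx).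
exists (RiAut (is_riAut_inv fA)); split.
  split; apply: riAut_inj => x /=; rewrite /pcomp.
    case fx: (riAut_fun f x) => [y|] //=.
    by rewrite ((pinvP x y fA).2 fx) /= fx.
  case gx: (pinv f x) => [y|] //=.
  by rewrite ((pinvP y x fA).1 gx) /= gx.
move=> g [E1 E2]; apply: riAut_inj => y /=.
case gy: (riAut_fun g y) => [x|].
  have := congr1 (fun h : riAut A => h y) E2.
  rewrite /= /pcomp gy /=; case fx: (riAut_fun f x) => [z|] //= gz.
  have [_ _ inj _] := riAutP g.
  by apply/(pinvP _ _ fA); rewrite fx (inj _ _ _ gz gy).
case py: (pinv f y) => [x|] //.
by have := fgf g E1 x y ((pinvP _ _ fA).1 py); rewrite gy.
Qed.

Import Order.Theory.

Section ProjectiveLimit.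
Context {d : Order.disp_t} {I : porderType d}.
Variables (F : I -> monoidType) (f : forall i j : I, (i <= j)%O -> F j -> F i).

Definition directed := (exists i : I, True) /\
  forall i j : I, exists k : I, (i <= k)%O /\ (j <= k)%O.

Definition inverse_system :=
  [/\ forall i j (ij : (i <= j)%O), monoid_morphism (f ij),
      forall i (x : F i), f (lexx i) x = x &
      forall i j k (ij : (i <= j)%O) (jk : (j <= k)%O) (x : F k),
        f ij (f jk x) = f (le_trans ij jk) x].

Definition compatible (x : forall i, F i) :=
  forall i j (ij : (i <= j)%O), f ij (x j) = x i.

Definition is_projective_limit (M : monoidType) (p : forall i, M -> F i) :=
  [/\ forall i, monoid_morphism (p i),
      forall m, compatible (p^~ m) &
      forall x, compatible x -> exists! m, forall i, p i m = x i].

End ProjectiveLimit.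

Definition projective_limit_of_finite_inverse_monoids (M : monoidType) :=
  exists (d : Order.disp_t) (I : porderType d) (F : I -> monoidType)
    (f : forall i j : I, (i <= j)%O -> F j -> F i) (p : forall i, M -> F i),
  [/\ @directed d I, inverse_system f,
      forall i, finite_monoid (F i) /\ inverse_monoid (F i) &
      is_projective_limit f p].

Definition residually_finite (M : monoidType) :=
  forall x y : M, x <> y -> exists (N : monoidType) (h : M -> N),
    [/\ finite_monoid N, monoid_morphism h & h x <> h y].

Section NotALimit.
Variable A : finType.
Hypothesis A0 : 0 < #|A|.

Let longid (n : nat) (x : seq A) := if n <= size x then Some x else None.

Let longidE n x y : longid n x = Some y <-> n <= size x /\ x = y.
Proof.
by rewrite /longid; case: ifP => nx; split=> [|[]] //; [case|move=> _ ->].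
Qed.

Let longid_riAut n : is_riAut (longid n).
Proof.
have E : fg_essential [set x : seq A | n <= size x].
  split.
  - by move=> x w /= nx; rewrite size_cat; apply: leq_trans nx (leq_addr _ _).
  - apply: (@fgI _ [seq val t | t <- enum {: n.-tuple A}]) => x; split=> /=.
      move=> nx; have /eqP sz : size (take n x) = n by rewrite size_takel.
      exists (take n x); last by exists (drop n x); rewrite cat_take_drop.
      by apply/mapP; exists (Tuple sz) => //; rewrite mem_enum.
    by move=> [_ /mapP[t _ ->] [w ->]]; rewrite size_cat size_tuple leq_addr.
  - move=> S rS [x Sx]; have /card_gt0P[a _] := A0.
    exists (x ++ nseq n a); split; last exact: rS.
    by rewrite /= size_cat size_nseq leq_addl.
have dE : pdom (longid n) = [set x | n <= size x].
  apply/seteqP; split=> x; first by move=> [y /longidE[]].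
  by move=> nx; exists x; apply/longidE.
have iE : pimg (longid n) = [set x | n <= size x].
  apply/seteqP; split=> x; first by move=> [y /longidE[ny <-]].
  by move=> nx; exists x; apply/longidE.
split; rewrite ?dE ?iE //.
  by move=> x x' y /longidE[_ ->] /longidE[_ ->].
move=> x y w /longidE[nx <-]; apply/longidE; split => //.
by rewrite size_cat (leq_trans nx) ?leq_addr.
Qed.

Let e n : riAut A := RiAut (longid_riAut n).

Let e_mul m n : m <= n -> e m * e n = e n /\ e n * e m = e n.
Proof.
move=> mn; split; apply: riAut_inj => x /=; rewrite /pcomp /longid.
  by case: ifP => //= nx; rewrite (leq_trans mn nx).
case: (leqP m (size x)) => //= xm.
by rewrite leqNgt (leq_trans xm mn).
Qed.

(* The restrictions of the identity to the ideals of words of length >= n form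
   a decreasing chain of idempotents, which is eventually constant in every
   finite quotient; its thread would be an element of riAut A below all of them,
   i.e. an empty map, but the empty right ideal is not essential. So the limit
   of the finite (Rees) quotients of riAut A has one more element, a zero, and
   it is with_zero (riAut A), not riAut A, that can be a projective limit. *)
Lemma riAut_not_projective_limit :
  ~ projective_limit_of_finite_inverse_monoids (riAut A).
Proof.
move=> [d [I [F [f [p [_ [_ _ _] fin [pM pf lim]]]]]]].
have stab i : exists N, forall n, N <= n -> p i (e n) = p i (e N).
  have [s sE] := (finite_seqP _).1 (fin i).1.
  have inf : exists v, forall N, exists2 n, N <= n & p i (e n) = v.
    apply/not_existsP => h.
    have /choice[b bP] v : exists N, forall n, N <= n -> p i (e n) <> v.
      have /existsNP[N hN] := h v.
      by exists N => n Nn ev; apply: hN; exists n.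
    pose N := \max_(v <- s) b v.
    have sN : p i (e N) \in s.
      have : [set: F i] (p i (e N)) by [].
      by rewrite sE.
    by apply: (bP (p i (e N)) N) => //; exact: leq_bigmax_seq.
  have [v hv] := inf; have [N _ eN] := hv 0; exists N => n Nn.
  have [m nm em] := hv n; rewrite eN.
  by rewrite -{1}(e_mul Nn).1 (pM i).2 eN -em -(pM i).2 (e_mul nm).2.
have [N NP] := choice stab.
pose x i := p i (e (N i)).
have cx : compatible f x.
  move=> i j ij; pose n := maxn (N i) (N j).
  by rewrite /x -(NP i n) ?leq_maxl // -(NP j n) ?leq_maxr // pf.
have [phi [phiE _]] := lim x cx.
have phi_e m : phi * e m = phi.
  have cphi : compatible f (fun i => p i phi) by exact: pf.
  have [y [_ uniq]] := lim _ cphi.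
  transitivity y; last exact: uniq.
  symmetry; apply: uniq => i.
  rewrite (pM i).2 phiE /x; pose n := maxn (N i) m.
  have mn : m <= n by exact: leq_maxr.
  by rewrite -(NP i n) ?leq_maxl // -(pM i).2 (e_mul mn).2.
have [[_ _ ess] _ _ _] := riAutP phi.
have [||z [[y zy] _]] := ess setT; [by [] | by exists [::] |].
have := congr1 (fun h : riAut A => h z) (phi_e (size z).+1).
by rewrite /= /pcomp /longid ltnn zy.
Qed.

End NotALimit.

(* Main.v *)
(** Call [g] a factor of [f] when [f = a * g * b]. In [riAut A] every element has
    finitely many factors. If [pdom f] is generated by [n] words, their images
    under [b] generate an essential right ideal contained in [pdom g]. A right
    ideal generated by [n] words is essential only if it contains all words of
    length at least [n], so [pdom g], and likewise [pimg g], contain all these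
    words. Hence [g] is determined by its restriction to the words of length at
    most [n], and it maps these to words of length at most [2n].

    So [riAut A] is the union of an increasing sequence of finite sets closed under
    factors. Collapsing the complement of such a set to a zero is a finite Rees
    quotient. A thread of the quotients that is nonzero somewhere is eventually a
    constant element of [riAut A]; the zero thread is the adjoined zero. *)
From HB Require Import structures.
Require Import Defs.
From mathcomp Require Import all_boot all_order.
From mathcomp Require Import boolp classical_sets cardinality.

Set Implicit Arguments.
Unset Strict Implicit.
Unset Printing Implicit Defensive.

Local Open Scope classical_set_scope.
Local Open Scope group_scope.

(** * Rees quotients by complements of factor-closed sets *)

Record factor_closed (M : monoidType) := FactorClosed {
  factor_closed_pred :> {pred M};
  factor_closed1 : 1 \in factor_closed_pred;
  factor_closedM : forall x y, x * y \in factor_closed_pred ->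
    x \in factor_closed_pred /\ y \in factor_closed_pred }.

Section ReesQuotient.
Variables (M : monoidType) (S : factor_closed M).

(** [None] is the common class of the complement of [S] and the zero of [with_zero M]. *)
Definition rees := option {x : M | x \in S}.

HB.instance Definition _ := Choice.on rees.

Definition rees_val (u : rees) : with_zero M := omap val u.
Definition rees_proj (x : with_zero M) : rees := obind insub x.

Lemma rees_valK : cancel rees_val rees_proj.
Proof. by move=> [u|] //; rewrite /rees_proj /= valK. Qed.

Lemma rees_projK x : x \in S -> rees_val (rees_proj (Some x)) = Some x.
Proof. by move=> xS; rewrite /rees_proj /= insubT. Qed.

Lemma rees_proj0 x : x \notin S -> rees_proj (Some x) = None.
Proof. by move=> xS; rewrite /rees_proj /= insubN. Qed.

(** Nothing in [S] is collapsed, so the class of a member of [S] is a singleton. This lifts nonzero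
    equations from the quotient. *)
Lemma rees_proj_eqSome x m : rees_proj x = rees_proj (Some m) -> m \in S ->
  x = Some m.
Proof.
case: x => [x|] E mS; last by move: (rees_projK mS); rewrite -E.
have [xS|/rees_proj0 x0] := boolP (x \in S).
  by rewrite -(rees_projK xS) E rees_projK.
by move: (rees_projK mS); rewrite -E x0.
Qed.

Definition rees_mul (u v : rees) : rees := rees_proj (rees_val u * rees_val v).

(** If one factor lies outside [S], so does the product, and both sides are zero. The monoid laws
    then pass to [rees] along this surjection. *)
Lemma rees_projM x y :
  rees_proj (x * y) = rees_mul (rees_proj x) (rees_proj y).
Proof.
case: x y => [x|] [y|]; rewrite /rees_mul //; last first.
  by case: (rees_val (rees_proj (Some x))).
have [xS|xS] := boolP (x \in S); last first.
  rewrite (rees_proj0 xS) [LHS]rees_proj0 //.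
  by apply: contra xS => /factor_closedM[].
have [yS|yS] := boolP (y \in S); last first.
  rewrite (rees_proj0 yS) [LHS]rees_proj0; first by case: (rees_val _).
  by apply: contra yS => /factor_closedM[].
by rewrite !rees_projK.
Qed.

Lemma rees_mulA : associative rees_mul.
Proof.
move=> u v w; rewrite -(rees_valK u) -(rees_valK v) -(rees_valK w).
by rewrite -!rees_projM mulgA.
Qed.

Lemma rees_mul1 : left_id (rees_proj 1) rees_mul.
Proof. by move=> u; rewrite -(rees_valK u) -rees_projM mul1g. Qed.

Lemma rees_mulr1 : right_id (rees_proj 1) rees_mul.
Proof. by move=> u; rewrite -(rees_valK u) -rees_projM mulg1. Qed.

HB.instance Definition _ := isMonoid.Build rees rees_mulA rees_mul1 rees_mulr1.

Lemma rees_mulgr0 (u : rees) : u * None = None.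
Proof. by case: u. Qed.

Lemma rees_projMg x y :
  rees_proj (x * y) = (rees_proj x : rees) * (rees_proj y : rees).
Proof. exact: rees_projM. Qed.

Lemma rees_proj_sandwich (x y : M) :
  (rees_proj (Some x) : rees) * rees_proj (Some y) * rees_proj (Some x) =
  rees_proj (Some (x * y * x)).
Proof.
by rewrite -(rees_projMg (Some x) (Some y)) -(rees_projMg (Some (x * y))).
Qed.

Lemma rees_proj_morphism : monoid_morphism (rees_proj : with_zero M -> rees).
Proof. by split=> // x y; exact: rees_projM. Qed.

Lemma rees_finite : finite_set [set x | x \in S] -> finite_monoid rees.
Proof.
move=> finS.
have : finite_set (rees_proj @` ([set None] `|` Some @` [set x | x \in S])).
  by apply: finite_image; rewrite finite_setU; split;
    [exact: finite_set1 | exact: finite_image].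
apply: sub_finite_set => u _; exists (rees_val u); last exact: rees_valK.
by case: u => [[x xS]|]; [right; exists x | left].
Qed.

(** The inverse [m'] of [m] is a factor of [m = m * m' * m], hence stays in [S]; uniqueness lifts to
    [M] by [rees_proj_eqSome]. *)
Lemma rees_inverse : inverse_monoid M -> inverse_monoid rees.
Proof.
move=> invM [[m mS]|]; last first.
  exists None; split=> // -[u|] // [_].
  by rewrite rees_mulgr0.
have [m' [[mm'm m'mm'] uniq]] := invM m.
have m'S : m' \in S.
  by move: mS; rewrite -mm'm => /factor_closedM[/factor_closedM[]].
have -> : Some (exist _ m mS) = rees_proj (Some m).
  by rewrite -[LHS]rees_valK.
exists (rees_proj (Some m')); split.
  by rewrite !rees_proj_sandwich mm'm m'mm'.
move=> u; rewrite -(rees_valK u); case: u => [[x xS]|] /=; last first.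
  by case=> + _; rewrite rees_mulgr0 => /(@rees_proj_eqSome None)-/(_ mS).
rewrite !rees_proj_sandwich => -[/rees_proj_eqSome-/(_ mS)[mxm]].
by move=> /rees_proj_eqSome-/(_ xS)[xmx]; rewrite (uniq x).
Qed.

End ReesQuotient.

(** * Monoids exhausted by finite factor-closed sets *)

Section FiniteFactors.
Variables (M : monoidType) (S : nat -> factor_closed M).
Hypothesis finS : forall n, finite_set [set x | x \in S n].
Hypothesis mono_S : forall m n, m <= n -> {subset S m <= S n}.
Hypothesis exhaust_S : forall x, exists n, x \in S n.

Lemma rees_proj_le m n (x : with_zero M) : m <= n ->
  rees_proj (S m) (rees_val (rees_proj (S n) x)) = rees_proj (S m) x.
Proof.
case: x => [x|] // mn; have [xS|xS] := boolP (x \in S n).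
  by rewrite rees_projK.
rewrite (rees_proj0 xS) [RHS]rees_proj0 //.
by apply: contra xS; exact: mono_S.
Qed.

Lemma exhaustion_projective_limit : inverse_monoid M ->
  projective_limit_of_finite_inverse_monoids (with_zero M).
Proof.
move=> invM; exists _, nat, (fun n => rees (S n)),
  (fun m n _ u => rees_proj (S m) (rees_val u)), (fun n => @rees_proj _ (S n)).
split.
- split; first by exists 0.
  by move=> m n; exists (maxn m n); rewrite !leEnat leq_maxl leq_maxr.
- split=> [m n mn|n u|l m n lm mn u].
  + split; first by rewrite rees_proj_le.
    move=> u v; rewrite -(rees_valK u) -(rees_valK v) -rees_projMg.
    by rewrite !rees_proj_le // rees_projMg.
  + exact: rees_valK.
  + exact: rees_proj_le.
- by move=> n; split; [exact: rees_finite | exact: rees_inverse].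
split=> [n|x m n mn|u cu].
- exact: rees_proj_morphism.
- exact: rees_proj_le.
have [[n [x xS unE]]|u0] :=
    pselect (exists n, exists2 x, x \in S n & u n = rees_proj (S n) (Some x)).
  have uE m : u m = rees_proj (S m) (Some x).
    (* Above level [n], only [x] itself projects to the nonzero class of [x]; from the common bound
       [l] it descends to [m]. *)
    pose l := maxn m n; have nl : n <= l := leq_maxr m n.
    have : rees_proj (S n) (rees_val (u l)) = rees_proj (S n) (Some x).
      by rewrite -unE; exact: (cu n l nl).
    move=> /rees_proj_eqSome-/(_ xS) ulE.
    by rewrite -(cu m l (leq_maxl m n)) ulE.
  exists (Some x); split=> [m //|y yE].
  by apply/esym/(@rees_proj_eqSome _ (S n)) => //; rewrite yE.
have uE m : u m = None.
  case um: (u m) => [[x xS]|] //; case: u0; exists m, x => //.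
  by rewrite um -[LHS]rees_valK.
(* [Some y] is excluded, being nonzero at a level that contains [y]. *)
exists None; split=> [m //|[y|] // yE]; have [n yS] := exhaust_S y.
by move: (rees_projK yS); rewrite yE uE.
Qed.

(** A level containing [y] separates it from every other element. *)
Lemma exhaustion_residually_finite : residually_finite M.
Proof.
move=> x y xy; have [m xS] := exhaust_S x; have [n yS] := exhaust_S y.
pose l := maxn m n; have {}yS : y \in S l := mono_S (leq_maxr m n) yS.
exists (rees (S l)), (fun z => rees_proj (S l) (Some z)); split.
- exact: rees_finite.
- by split=> // a b; exact: rees_projMg (Some a) (Some b).
- by move=> /rees_proj_eqSome-/(_ yS)[].
Qed.

End FiniteFactors.

(** * Finite generating sets of essential right ideals *)

Section DenseLists.
Variable A : finType.
Implicit Types (x w p : seq A) (P : seq (seq A)).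

(** Every word is prefix-comparable with a member of [P]; equivalently, [P] generates an essential
    right ideal. *)
Definition dense_list P :=
  forall w, exists2 p, p \in P & exists u v, p ++ u = w ++ v.

Definition quotient_by (a : A) p :=
  if p is b :: q then if b == a then Some q else None else None.

Lemma quotient_by_some a p q : quotient_by a p = Some q <-> p = a :: q.
Proof.
case: p => [|b p] //=; case: eqP => [->|ba]; split=> // -[] //.
  by move=> ->.
by move=> <-.
Qed.

Lemma mem_quotient a P q : (q \in pmap (quotient_by a) P) = (a :: q \in P).
Proof.
rewrite mem_pmap; apply/mapP/idP => [[p pP /esym/quotient_by_some <-//]|qP].
by exists (a :: q) => //; apply/esym/quotient_by_some.
Qed.

(** A nonempty word comparable with [a :: w] begins with [a]. *)
Lemma dense_quotient a P : [::] \notin P -> dense_list P ->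
  dense_list (pmap (quotient_by a) P).
Proof.
move=> nP dP w; have [[|b q] pP [u [v]]] := dP (a :: w).
  by rewrite pP in nP.
by move=> [ba E]; exists q; [rewrite mem_quotient -ba | exists u, v].
Qed.

(** Induction on [x], replacing [P] by its left quotient by the first letter [a]. This list is
    strictly shorter: by density some member of [P] begins with a letter other than [a]. *)
Lemma dense_list_prefix P x : 1 < #|A| -> dense_list P -> size P <= size x ->
  exists2 p, p \in P & exists w, x = p ++ w.
Proof.
move=> A2; elim: x P => [|a x IH] P dP Px.
  by have [p] := dP [::]; rewrite (size0nil (eqP (_ : size P == 0))) // -leqn0.
have [nP|nP] := boolP ([::] \in P); first by exists [::] => //; exists (a :: x).
have [q qP [w ->]] : exists2 q, q \in pmap (quotient_by a) P &
    exists w, x = q ++ w.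
  apply: IH; first exact: dense_quotient.
  rewrite -ltnS; apply: leq_trans Px; rewrite size_pmap.
  rewrite -(count_predC (quotient_by a) P) -[X in X < _]addn0 ltn_add2l -has_count.
  have /card_gt1P[b [c [_ _ bc]]] := A2.
  have [b' b'a] : exists b', b' != a.
    by have [ba|] := eqVneq b a; [exists c; rewrite -ba eq_sym | exists b].
  have [q + _] := dense_quotient b' nP dP [::]; rewrite mem_quotient => qP.
  by apply/hasP; exists (b' :: q) => //=; rewrite (negPf b'a).
by exists (a :: q); [rewrite -mem_quotient | exists w].
Qed.

(** Essentiality is tested on the principal right ideal generated by [w]. *)
Lemma essential_dense R P : fg_essential R ->
  (forall x, R x -> exists2 p, p \in P & exists w, x = p ++ w) -> dense_list P.
Proof.
move=> [_ _ eR] RP w.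
have [||x [/RP[p pP [u ->]] [v E]]] := eR [set x | exists v, x = w ++ v].
- by move=> x y [v ->]; exists (v ++ y); rewrite catA.
- by exists w, [::]; rewrite cats0.
by exists p => //; exists u, v.
Qed.

End DenseLists.

(** * Finiteness of the sets of factors in [riAut A] *)

Section Factors.
Variable A : finType.
Hypothesis A2 : 1 < #|A|.
Implicit Types (f g h a b : riAut A) (x y w : seq A).

Definition dom_generated_by n f := exists2 P : seq (seq A), size P <= n &
  pdom f = [set p ++ w | p in [set` P] & w in [set: seq A]].

(** The images under [h] of the generators of [pdom f] form a dense list of at most [n] words, so
    [dense_list_prefix] applies. *)
Lemma deep_in_image n f h y : dom_generated_by n f -> pdom f `<=` pdom h ->
  n <= size y -> exists2 x, pdom f x & h x = Some y.
Proof.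
move=> [P Pn fP] sub ny; have hA := riAutP h; have [_ _ _ eh] := hA.
have [df _ _ _] := riAutP f; have imE := fg_essential_image hA df sub.
have PE := fgP fP.
have [||q] := @dense_list_prefix A (pmap h P) y A2.
- apply: (essential_dense imE) => z [x /PE[p pP [w ->]] hpw].
  have [|q hp] := sub p; first by apply/PE; exists p => //; exists [::]; rewrite cats0.
  exists q; first by rewrite mem_pmap; apply/mapP; exists p.
  by exists w; move: hpw; rewrite (eh _ _ _ hp) => -[].
- by apply: leq_trans ny; apply: leq_trans Pn; rewrite size_pmap count_size.
rewrite mem_pmap => /mapP[p pP /esym hp] [w ->]; exists (p ++ w); last exact: eh.
by apply/PE; exists p => //; exists w.
Qed.

(** Products act from right to left, so [pdom f] lies in the domains of [b] and [g * b]. Taking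
    these as [h] in [deep_in_image] gives the two claims. *)
Lemma factor_deep n f a g b y : dom_generated_by n f -> f = a * g * b ->
  n <= size y -> pdom g y /\ pimg g y.
Proof.
move=> fn fE ny; split.
  have [|x [z] + bx] := @deep_in_image n f b y fn _ ny.
    by move=> x [z]; rewrite fE /= /pcomp; case bx: (b x) => [t|] // _; exists t.
  by rewrite fE /= /pcomp bx /=; case gy: (g y) => [t|] // _; exists t.
have [|x _] := @deep_in_image n f (g * b) y fn _ ny.
  move=> x [z]; rewrite fE /= /pcomp /pdom /=; case: (riAut_fun b x) => [t|] //=.
  by case: (riAut_fun g t) => [s|] // _; exists s.
by rewrite /= /pcomp; case: (b x) => [t|] //= gt; exists t.
Qed.

(** If [y] is longer than [n], its prefix of length [n] has a preimage [x']. Injectivity gives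
    [x = x' ++ drop n y], so at most [n] letters of [y] follow that prefix. *)
Lemma riAut_size_le n g x y : (forall z, n <= size z -> pimg g z) ->
  size x <= n -> g x = Some y -> size y <= n + n.
Proof.
move=> deep xn gx; have [//|yn] := leqP (size y) n.
  by move=> yn; exact: leq_trans yn (leq_addr _ _).
have szn : size (take n y) = n by rewrite size_takel // ltnW.
have [|x' gx'] := deep (take n y); first by rewrite szn.
have [_ _ inj eg] := riAutP g.
have xE : x = x' ++ drop n y.
  by apply: inj gx _; rewrite (eg _ _ _ gx') cat_take_drop.
rewrite -(cat_take_drop n y) size_cat szn leq_add2l.
by apply: leq_trans xn; rewrite xE size_cat leq_addl.
Qed.

Lemma finite_deep n :
  finite_set [set g : riAut A | forall z, n <= size z -> pdom g z /\ pimg g z].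
Proof.
(* For [g] in the set, [insub] loses no value, by [riAut_size_le]. *)
pose code g : {ffun n.-bseq A -> option ((n + n).-bseq A)} :=
  [ffun x : n.-bseq A => obind insub (g x)].
have codeE g x : (forall z, n <= size z -> pimg g z) -> size x <= n ->
    g x = obind (fun s : n.-bseq A => omap val (code g s)) (insub x).
  move=> deep xn; rewrite insubT /= ffunE /=.
  case gx: (riAut_fun g x) => [y|] //=.
  by rewrite insubT //; exact: riAut_size_le gx.
suff inj : {in [set g : riAut A | forall z, n <= size z -> pdom g z /\ pimg g z] &,
    injective code}.
  by rewrite -(eq_finite_set (inj_card_eq inj)); exact: finite_finset.
move=> g h; rewrite !inE => gd hd E.
have gh x : size x <= n -> g x = h x.
  by move=> xn; rewrite !codeE ?E // => z; [move=> /hd[] | move=> /gd[]].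
(* On longer words, equivariance determines both maps from the prefix of length [n], where [g] is
   defined. *)
apply: riAut_inj => x; have [/gh//|nx] := leqP (size x) n.
have sz : size (take n x) = n by rewrite size_takel // ltnW.
have [[y gy] _] : pdom g (take n x) /\ pimg g (take n x) by apply: gd; rewrite sz.
have [_ _ _ eg] := riAutP g; have [_ _ _ eh] := riAutP h.
by rewrite -(cat_take_drop n x) (eg _ _ _ gy) (eh _ y) // -gh // sz.
Qed.

(** The bound is [n.+1] because the unit, whose domain needs one generator, must already lie in the
    set at [0]. *)
Definition factors n : {pred riAut A} :=
  fun g => `[< exists f a b, dom_generated_by n.+1 f /\ f = a * g * b >].

Lemma factors1 n : 1 \in factors n.
Proof.
apply/asboolP; exists 1, 1, 1; rewrite !mulg1; split=> //.
exists [:: [::]] => //; apply/seteqP; split=> x _; last by exists x.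
exists [::]; first by rewrite /= inE.
by exists x.
Qed.

Lemma factorsM n g h : g * h \in factors n -> g \in factors n /\ h \in factors n.
Proof.
move=> /asboolP[f [a [b [fn fE]]]]; split; apply/asboolP.
  by exists f, a, (h * b); split; rewrite // fE !mulgA.
by exists f, (a * g), b; split; rewrite // fE !mulgA.
Qed.

Definition riAut_factors n := FactorClosed (factors1 n) (@factorsM n).

Lemma factors_finite n : finite_set [set g | g \in riAut_factors n].
Proof.
apply: sub_finite_set (finite_deep n.+1) => g /asboolP[f [a [b [fn fE]]]] z.
exact: factor_deep fn fE.
Qed.

Lemma factors_mono m n : m <= n -> {subset riAut_factors m <= riAut_factors n}.
Proof.
move=> mn g /asboolP[f [a [b [[P Pm fP] fE]]]]; apply/asboolP; exists f, a, b.
by split=> //; exists P => //; exact: leq_trans Pm _.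
Qed.

Lemma factors_exhaust g : exists n, g \in riAut_factors n.
Proof.
have [[_ [P gP] _] _ _ _] := riAutP g.
exists (size P); apply/asboolP; exists g, 1, 1; rewrite mul1g mulg1.
by split=> //; exists P.
Qed.

End Factors.

Theorem corollary2p6 (k : nat) (A : finType) (cardA : #|A| = k) (k_ge2 : 2 <= k) :
  projective_limit_of_finite_inverse_monoids (with_zero (riAut A)) /\
  residually_finite (riAut A).
Proof.
have A2 : 1 < #|A| by rewrite cardA.
have fin := factors_finite A2; have mono := @factors_mono A.
have exh := @factors_exhaust A; split.
  exact: exhaustion_projective_limit fin mono exh (@riAut_inverse A).
exact: exhaustion_residually_finite fin mono exh.
Qed.
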